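(* Let $\sigma\ge0$ be a constant, $s\in\mathbb{C}$ with $\Re s>0$ and $S_x=1+\sigma/s$. Consider the constant coefficient (Laplace transformed) semi-discrete PML $$s^2\widehat{\mathbf{E}}_z=-\frac{1}{S_x^2}\mathbf{P}_{xy}^{-1}(D_x^T\otimes I_y)\mathbf{P}_{xy}(D_x\otimes I_y)\widehat{\mathbf{E}}_z-\mathbf{P}_{xy}^{-1}(I_x\otimes D_y^T)\mathbf{P}_{xy}(I_x\otimes D_y)\widehat{\mathbf{E}}_z-\frac{s}{S_x}\mathbf{P}_{xy}^{-1}\left(B_x^+\otimes P_y+P_x\otimes B_y^+\right)\widehat{\mathbf{E}}_z.$$ All solutions satisfy the energy equation $\widehat{\mathcal{E}}^{(2)}_{h\sigma}(s)=0$, where $$\widehat{\mathcal{E}}^{(2)}_{h\sigma}(s)=\Re s\,|s|^2\,\widehat{\mathbf{E}}_z^*\mathbf{P}_{xy}\widehat{\mathbf{E}}_z+\frac{1}{|S_x|^2}\Re\left(\frac{(sS_x)^*}{S_x}\right)\left((D_x\otimes I_y)\widehat{\mathbf{E}}_z\right)^*\mathbf{P}_{xy}\left((D_x\otimes I_y)\widehat{\mathbf{E}}_z\right)+\Re s\left((I_x\otimes D_y)\widehat{\mathbf{E}}_z\right)^*\mathbf{P}_{xy}\left((I_x\otimes D_y)\widehat{\mathbf{E}}_z\right)$$ $$\qquad+|s|^2\Re\left(\frac{1}{S_x}\right)\widehat{\mathbf{E}}_z^*\left(B_x^+\otimes P_y+P_x\otimes B_y^+\right)\widehat{\mathbf{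E}}_z.$$
   Context: Summation-by-parts (SBP) operators: for $\xi\in\{x,y\}$, $N_\xi\ge2$ is the number of grid points, $I_\xi$ the $N_\xi\times N_\xi$ identity, and $D_\xi=P_\xi^{-1}Q_\xi$ is a real $N_\xi\times N_\xi$ matrix (approximating $\partial/\partial\xi$) with $P_\xi$ diagonal and positive definite and $Q_\xi+Q_\xi^T=E_{R\xi}-E_{L\xi}$, where $E_{L\xi}=\mathrm{diag}(1,0,\dots,0)$, $E_{R\xi}=\mathrm{diag}(0,\dots,0,1)$. Write $B_\xi^{+}=E_{R\xi}+E_{L\xi}$. $\otimes$ is the Kronecker product and $\mathbf{P}_{xy}=P_x\otimes P_y$. The unknown $\widehat{\mathbf{E}}_z$ is a vector in $\mathbb{C}^{N_xN_y}$. The superscript $^*$ denotes complex conjugation of scalars and conjugate transpose of vectors. *)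

(* Defs.v *)
From HB Require Import structures.
From mathcomp Require Import all_boot all_order all_algebra.
From mathcomp Require Import reals.
From mathcomp Require Export mxtens complex.

Set Implicit Arguments.
Unset Strict Implicit.
Unset Printing Implicit Defensive.

Import Order.TTheory GRing.Theory Num.Theory.
Local Open Scope ring_scope.
Local Open Scope complex_scope.
Local Open Scope sesquilinear_scope.

Definition E_L (R : realType) (N : nat) : 'M[R]_N :=
  diag_mx (\row_(j < N) (j == 0 :> nat)%:R).

Definition E_R (R : realType) (N : nat) : 'M[R]_N :=
  diag_mx (\row_(j < N) (j.+1 == N)%:R).

Definition B_plus (R : realType) (N : nat) : 'M[R]_N := E_R R N + E_L R N.

Definition posdef (R : realType) (N : nat) (P : 'M[R]_N) : Prop :=
  P^T = P /\ forall v : 'cV[R]_N, v != 0 -> 0 < (v^T *m P *m v) 0 0.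

(* Summation-by-parts operator D = P^-1 Q on N >= 2 grid points.              *)
Definition is_sbp (R : realType) (N : nat) (P Q D : 'M[R]_N) : Prop :=
  [/\ (2 <= N)%N, is_diag_mx P, posdef P,
      Q + Q^T = E_R R N - E_L R N & D = invmx P *m Q].

Definition cmx (R : realType) (m n : nat) (A : 'M[R]_(m, n)) : 'M[R[i]]_(m, n) :=
  map_mx (fun x : R => x%:C) A.

Definition qform (R : realType) (n : nat) (A : 'M[R[i]]_n) (v : 'cV[R[i]]_n) :
    R[i] :=
  (v ^t* *m A *m v) 0 0.

Definition pml_S (R : realType) (sigma : R) (s : R[i]) : R[i] :=
  1 + sigma%:C / s.

Definition P_xy (R : realType) (Nx Ny : nat) (Px : 'M[R]_Nx) (Py : 'M[R]_Ny) :
    'M[R[i]]_(Nx * Ny) :=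
  cmx (Px *t Py).

Definition D_xI (R : realType) (Nx Ny : nat) (Dx : 'M[R]_Nx) :
    'M[R[i]]_(Nx * Ny) :=
  cmx (Dx *t (1%:M : 'M[R]_Ny)).

Definition I_xD (R : realType) (Nx Ny : nat) (Dy : 'M[R]_Ny) :
    'M[R[i]]_(Nx * Ny) :=
  cmx ((1%:M : 'M[R]_Nx) *t Dy).

Definition B_xy (R : realType) (Nx Ny : nat) (Px : 'M[R]_Nx) (Py : 'M[R]_Ny) :
    'M[R[i]]_(Nx * Ny) :=
  cmx (B_plus R Nx *t Py + Px *t B_plus R Ny).

Definition pml_equation (R : realType) (Nx Ny : nat)
    (Px Dx : 'M[R]_Nx) (Py Dy : 'M[R]_Ny) (sigma : R) (s : R[i])
    (Ez : 'cV[R[i]]_(Nx * Ny)) : Prop :=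
  let Sx := pml_S sigma s in
  let P := P_xy Px Py in
  s ^+ 2 *: Ez =
    - (1 / Sx ^+ 2) *:
        (invmx P *m D_xI Ny Dx^T *m P *m D_xI Ny Dx *m Ez)
    - invmx P *m I_xD Nx Dy^T *m P *m I_xD Nx Dy *m Ez
    - (s / Sx) *: (invmx P *m B_xy Px Py *m Ez).

(* 'Re and `|_| are R[i]-valued here, so the energy is an element of R[i].    *)
Definition pml_energy (R : realType) (Nx Ny : nat)
    (Px Dx : 'M[R]_Nx) (Py Dy : 'M[R]_Ny) (sigma : R) (s : R[i])
    (Ez : 'cV[R[i]]_(Nx * Ny)) : R[i] :=
  let Sx := pml_S sigma s in
  let P := P_xy Px Py in
  'Re s * `|s| ^+ 2 * qform P Ez
  + 1 / `|Sx| ^+ 2 * 'Re (Num.conj (s * Sx) / Sx) * qform P (D_xI Ny Dx *m Ez)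
  + 'Re s * qform P (I_xD Nx Dy *m Ez)
  + `|s| ^+ 2 * 'Re (1 / Sx) * qform (B_xy Px Py) Ez.

(* Main.v *)
Require Import Defs.
From HB Require Import structures.
From mathcomp Require Import all_boot all_order all_algebra.
From mathcomp Require Import reals.
From mathcomp Require Import ring.

Import Order.TTheory GRing.Theory Num.Theory.
Local Open Scope ring_scope.
Local Open Scope complex_scope.
Local Open Scope sesquilinear_scope.

(** The energy identity is the real part of the equation tested against
    [s E]: multiply the equation on the left by [s^* E^* P], where [P] is the
    Kronecker product of the two norm matrices, and take real parts.

    Since [P] is invertible, testing cancels every [P^-1].  The difference
    operators are real, so the transpose in front of [P] is moved onto the
    left factor [E^*], and each spatial term becomes a quadratic form
    (lemma [qform_weak]).  These forms, of matrix [P] and of the boundary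
    matrix, are attached to real symmetric matrices, so their values are real
    (lemma [qform_real]) and only the scalar coefficients are affected when
    real parts are taken.  What is left is a scalar computation
    (lemma [tested_energy]), whose one non-obvious point is
    [s^* / Sx^2 = ((s Sx)^* / Sx) / |Sx|^2]. *)

Lemma mulmx_adj (C : numClosedFieldType) (m n p : nat)
    (A : 'M[C]_(m, n)) (B : 'M[C]_(n, p)) :
  (A *m B) ^t* = B ^t* *m A ^t*.
Proof. by rewrite trmx_mul map_mxM. Qed.

Lemma adj_cmx (R : realType) (m n : nat) (A : 'M[R]_(m, n)) :
  (cmx A) ^t* = cmx A^T.
Proof. by apply/matrixP=> i j; rewrite !mxE; exact: conjc_real. Qed.

Lemma qform_real (R : realType) (n : nat) (A : 'M[R]_n) (v : 'cV[R[i]]_n) :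
  A^T = A -> qform (cmx A) v \is Num.real.
Proof.
move=> symA; apply/CrealP; rewrite /qform.
set M := v ^t* *m _ *m v.
have <- : M ^t* 0 0 = Num.conj (M 0 0) by rewrite !mxE.
by rewrite /M !mulmx_adj trmxCK adj_cmx symA mulmxA.
Qed.

(** [D] is real, so its transpose is its adjoint and can be moved onto the
    test vector. *)
Lemma qform_weak (R : realType) (n : nat) (P D : 'M[R]_n)
    (v : 'cV[R[i]]_n) :
  v ^t* *m cmx D^T *m cmx P *m cmx D *m v
  = (cmx D *m v) ^t* *m cmx P *m (cmx D *m v).
Proof. by rewrite mulmx_adj adj_cmx !mulmxA. Qed.

Lemma posdef_unit (R : realType) (n : nat) (P : 'M[R]_n) :
  posdef P -> P \in unitmx.
Proof.
case=> _ posP; rewrite -row_free_unit -kermx_eq0; apply/rowV0P => u.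
move/sub_kermxP => uP; apply/eqP; apply: contraT => nz_u.
have /posP : u^T != 0 by rewrite -(inj_eq trmx_inj) trmxK trmx0.
by rewrite trmxK uP mul0mx mxE ltxx.
Qed.

Lemma B_plus_sym (R : realType) (n : nat) : (B_plus R n)^T = B_plus R n.
Proof. by rewrite /B_plus linearD /= !tr_diag_mx. Qed.

(** Multiplying the tested equation by [s^*] turns [s ^+ 2 * a] into
    [`|s| ^+ 2 * s * a] and [s / S * d] into [`|s| ^+ 2 / S * d]; as [a], [b],
    [c], [d] (the values of the four quadratic forms) are real, taking real
    parts acts on the coefficients alone.  The case [S = 0] is consistent with
    the convention [0^-1 = 0]. *)
Lemma tested_energy (C : numClosedFieldType) (s S a b c d : C) :
    a \is Num.real -> b \is Num.real -> c \is Num.real -> d \is Num.real ->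
    s ^+ 2 * a = - (1 / S ^+ 2) * b - c - s / S * d ->
  'Re s * `|s| ^+ 2 * a + 1 / `|S| ^+ 2 * 'Re (Num.conj (s * S) / S) * b
  + 'Re s * c + `|s| ^+ 2 * 'Re (1 / S) * d = 0.
Proof.
move=> ra rb rc rd eqn.
have rn (z : C) : `|z| ^+ 2 \is Num.real by rewrite realX ?normr_real.
have coefS : 1 / `|S| ^+ 2 * (Num.conj (s * S) / S) = Num.conj s / S ^+ 2.
  have [-> | nzS] := eqVneq S 0; first by rewrite expr0n invr0 !mulr0.
  have nzSc : Num.conj S != 0 by rewrite conjC_eq0.
  by rewrite normCK rmorphM /=; field; rewrite nzS.
transitivity ('Re (Num.conj s *
    (s ^+ 2 * a + 1 / S ^+ 2 * b + c + s / S * d))); last first.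
  by rewrite eqn [X in _ * X](_ : _ = 0) ?mulr0 ?raddf0 //; ring.
have -> : Num.conj s * (s ^+ 2 * a + 1 / S ^+ 2 * b + c + s / S * d)
    = s * `|s| ^+ 2 * a + Num.conj s / S ^+ 2 * b + Num.conj s * c
      + `|s| ^+ 2 * (1 / S) * d.
  by rewrite normCK; ring.
rewrite -coefS !raddfD /= !(ReMr ra, ReMr rb, ReMr rc, ReMr rd) Re_conj.
have rS : 1 / `|S| ^+ 2 \is Num.real by rewrite realM ?real1 ?realV.
by rewrite (ReMr (rn s)) (ReMl rS) (ReMl (rn s)).
Qed.

Theorem theorem5p4 (R : realType) (Nx Ny : nat)
    (Px Qx Dx : 'M[R]_Nx) (Py Qy Dy : 'M[R]_Ny)
    (hx : is_sbp Px Qx Dx) (hy : is_sbp Py Qy Dy)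
    (sigma : R) (hsigma : 0 <= sigma)
    (s : R[i]) (hs : 0 < 'Re s)
    (Ez : 'cV[R[i]]_(Nx * Ny)) :
  pml_equation Px Dx Py Dy sigma s Ez ->
  pml_energy Px Dx Py Dy sigma s Ez = 0.
Proof.
case: hx hy => [Nx_ge2 _ posPx _ _] [Ny_ge2 _ posPy _ _].
have [[symPx _] [symPy _]] := (posPx, posPy).
have symP : (Px *t Py)^T = Px *t Py by rewrite trmx_tens symPx symPy.
have symB : (B_plus R Nx *t Py + Px *t B_plus R Ny)^T
    = B_plus R Nx *t Py + Px *t B_plus R Ny.
  by rewrite linearD /= !trmx_tens symPx symPy !B_plus_sym.
have unitP : P_xy Px Py \in unitmx.
  rewrite map_unitmx tensmx_unit ?posdef_unit // -lt0n; exact: ltnW.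
rewrite /pml_equation /pml_energy => eqn.
apply: tested_energy; rewrite ?qform_real //.
(* Testing with [Ez^* P]: the product with [P] cancels each [P^-1], and
   [qform_weak] recognises the stiffness terms. *)
have := congr1 (fun v => (Ez ^t* *m P_xy Px Py *m v) 0 0) eqn.
have DxT : D_xI Ny Dx^T = cmx (Dx *t (1%:M : 'M[R]_Ny))^T.
  by rewrite trmx_tens trmx1.
have DyT : I_xD Nx Dy^T = cmx ((1%:M : 'M[R]_Nx) *t Dy)^T.
  by rewrite trmx_tens trmx1.
rewrite !mulmxBr -!scalemxAr !mulmxA !(mulmxK unitP) DxT DyT.
rewrite /P_xy /D_xI /I_xD !qform_weak.
by rewrite /qform !mxE.
Qed.
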